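(* Consider the unconstrained problem $$\min_{x=(x_1,x_2)\in\mathbb{R}^{d}}\ \theta(x)=\theta_1(x_1)+\theta_2(x_2)+\tfrac12x^\top Hx+g^\top x .$$ Assume $H_{ii}+\Sigma_i+R_i\succ0$ for $i=1,2$. Let $\{(x_1^k,x_2^k)\}$ be generated by the 2-block cyclic proximal BCD method (described in the context). Then the whole sequence $\{(x_1^k,x_2^k)\}$ converges to an optimal solution of the problem.
   Context: Setting: $\theta_i:\mathbb{R}^{d_i}\to(-\infty,+\infty]$ ($i=1,2$) are closed proper convex functions, $d=d_1+d_2$, $g=(g_1,g_2)\in\mathbb{R}^d$, $H=\begin{bmatrix}H_{11}&H_{12}\\H_{12}^\top&H_{22}\end{bmatrix}\in\mathbb{R}^{d\times d}$ is symmetric positive semidefinite with $H_{ij}\in\mathbb{R}^{d_i\times d_j}$. The problem is assumed to have an optimality (KKT) point, i.e. $\bar x=(\bar x_1,\bar x_2)$ with $-(H\bar x+g)_i\in\partial\theta_i(\bar x_i)$ for $i=1,2$. $\Sigma_1,\Sigma_2$ are symmetric positive semidefinite matrices such that, for $i=1,2$, $(x_i-\hat x_i)^\top(w_i-\hat w_i)\ge\|x_i-\hat x_i\|^2_{\Sigma_i}$ for all $x_i,\hat x_i\in\mathrm{dom}(\theta_i)$, $w_i\in\partial\theta_i(x_i)$, $\hat w_i\in\partial\theta_i(\hat x_i)$. $R_i\in\mathbb{R}^{d_i\times d_i}$ ($i=1,2$) are symmetric positive semidefinite matrices. For a symmetric positive semidefinite $G$, $\|v\|_G^2=v^\top Gv$;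 $\succ0$ means positive definite. 2-block cyclic proximal BCD: from an initial $(x_1^0,x_2^0)$, for $k\ge0$, $$\begin{aligned} x_1^{k+1}&:=\arg\min_{x_1\in\mathbb{R}^{d_1}}\Big\{\theta_1(x_1)+\tfrac12x_1^\top H_{11}x_1+x_1^\top H_{12}x_2^k+g_1^\top x_1+\tfrac12\|x_1-x_1^k\|^2_{R_1}\Big\},\\ x_2^{k+1}&:=\arg\min_{x_2\in\mathbb{R}^{d_2}}\Big\{\theta_2(x_2)+\tfrac12x_2^\top H_{22}x_2+(x_1^{k+1})^\top H_{12}x_2+g_2^\top x_2+\tfrac12\|x_2-x_2^k\|^2_{R_2}\Big\}, \end{aligned}$$ i.e. each block minimizes $\theta$ plus the proximal term with the other block fixed (terms not depending on the minimization variable are dropped). *)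

(* Defs.v *)
From HB Require Import structures.
From mathcomp Require Export all_boot all_order all_algebra.
From mathcomp Require Export all_classical all_reals all_analysis.

Set Implicit Arguments.
Unset Strict Implicit.
Unset Printing Implicit Defensive.

Import Order.TTheory GRing.Theory Num.Theory.
Import numFieldNormedType.Exports.

Local Open Scope classical_set_scope.
Local Open Scope ring_scope.

Definition dotv {R : realType} {n : nat} (u v : 'cV[R]_n) : R :=
  (u^T *m v) 0 0.

(* the squared seminorm |v|_G^2 = v^T G v *)
Definition sqnorm {R : realType} {n : nat} (G : 'M[R]_n) (v : 'cV[R]_n) : R :=
  (v^T *m G *m v) 0 0.

Definition psdmx {R : realType} {n : nat} (G : 'M[R]_n) : Prop :=
  G^T = G /\ forall v : 'cV[R]_n, 0 <= sqnorm G v.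

Definition pdmx {R : realType} {n : nat} (G : 'M[R]_n) : Prop :=
  G^T = G /\ forall v : 'cV[R]_n, v != 0 -> 0 < sqnorm G v.

Definition dom {R : realType} {n : nat} (f : 'cV[R]_n -> \bar R)
  : set 'cV[R]_n := [set x | (f x < +oo)%E].

Definition proper_fun {R : realType} {n : nat} (f : 'cV[R]_n -> \bar R) : Prop :=
  (forall x, (-oo < f x)%E) /\ dom f !=set0.

(* t is restricted to ]0, 1[ so that no product 0 * +oo occurs *)
Definition convex_efun {R : realType} {n : nat} (f : 'cV[R]_n -> \bar R) : Prop :=
  forall (x y : 'cV[R]_n) (t : R), 0 < t -> t < 1 ->
    (f (t *: x + (1 - t) *: y)%R <= t%:E * f x + (1 - t)%:E * f y)%E.

(* for a proper convex function, closedness is lower semicontinuity *)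
Definition closed_proper_convex {R : realType} {n : nat}
    (f : 'cV[R]_n -> \bar R) : Prop :=
  [/\ lower_semicontinuous f, proper_fun f & convex_efun f].

Definition subdiff {R : realType} {n : nat} (f : 'cV[R]_n -> \bar R)
    (x : 'cV[R]_n) : set 'cV[R]_n :=
  [set w | forall y, (f x + (dotv w (y - x))%:E <= f y)%E].

Definition strong_monotone_subdiff {R : realType} {n : nat}
    (f : 'cV[R]_n -> \bar R) (Sigma : 'M[R]_n) : Prop :=
  forall x x' w w' : 'cV[R]_n, dom f x -> dom f x' ->
    subdiff f x w -> subdiff f x' w' ->
    sqnorm Sigma (x - x') <= dotv (x - x') (w - w').

Definition argmin {R : realType} {n : nat} (f : 'cV[R]_n -> \bar R)
  : set 'cV[R]_n := [set x | forall y, (f x <= f y)%E].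

Section two_block_problem.
Context {R : realType} {d1 d2 : nat}.
Variables (theta1 : 'cV[R]_d1 -> \bar R) (theta2 : 'cV[R]_d2 -> \bar R).
Variables (H : 'M[R]_(d1 + d2)) (g : 'cV[R]_(d1 + d2)).

Definition objective (x : 'cV[R]_(d1 + d2)) : \bar R :=
  (theta1 (usubmx x) + theta2 (dsubmx x)
   + (2^-1 * sqnorm H x + dotv g x)%:E)%E.

Definition kkt_point (x : 'cV[R]_(d1 + d2)) : Prop :=
  subdiff theta1 (usubmx x) (usubmx (- (H *m x + g))) /\
  subdiff theta2 (dsubmx x) (dsubmx (- (H *m x + g))).

(* x1k is the proximal center, x2 the fixed second block *)
Definition block1_objective (R1 : 'M[R]_d1) (x1k : 'cV[R]_d1)
    (x2 : 'cV[R]_d2) (x1 : 'cV[R]_d1) : \bar R :=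
  (theta1 x1 + (2^-1 * sqnorm (ulsubmx H) x1 + dotv x1 (ursubmx H *m x2)
                + dotv (usubmx g) x1 + 2^-1 * sqnorm R1 (x1 - x1k))%:E)%E.

(* x2k is the proximal center, x1 the fixed first block *)
Definition block2_objective (R2 : 'M[R]_d2) (x2k : 'cV[R]_d2)
    (x1 : 'cV[R]_d1) (x2 : 'cV[R]_d2) : \bar R :=
  (theta2 x2 + (2^-1 * sqnorm (drsubmx H) x2 + dotv x1 (ursubmx H *m x2)
                + dotv (dsubmx g) x2 + 2^-1 * sqnorm R2 (x2 - x2k))%:E)%E.

Definition cyclic_prox_bcd (R1 : 'M[R]_d1) (R2 : 'M[R]_d2)
    (x1 : nat -> 'cV[R]_d1) (x2 : nat -> 'cV[R]_d2) : Prop :=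
  forall k : nat,
    argmin (block1_objective R1 (x1 k) (x2 k)) (x1 k.+1) /\
    argmin (block2_objective R2 (x2 k) (x1 k.+1)) (x2 k.+1).

End two_block_problem.

(* Main.v *)
Require Import Defs.
From mathcomp Require Import ring lra.

(** Fix a KKT point [p] and write [a], [b] for the errors of the two blocks with
    respect to [p]. The minimizer of each block subproblem comes with a
    subgradient ([bcd_subdiff]); comparing it with the subgradient at [p] by strong
    monotonicity and completing squares shows that the energy
    [|a|_R1^2 + |b|_(H22 + R2)^2] drops at each step by at least a nonnegative
    dissipation ([energy_descent], [bcd_energy_descent]). That the sweep is not
    symmetric in the blocks is what makes two blocks work: the cross terms in
    [H12] with the old and the new second block are absorbed by two full
    [H]-seminorms, at the price of a telescoping term in [H22].

    Three consequences follow. Positive definiteness of [Hii + Sigma_i + Ri] and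
    the descent bound the new errors by a multiple of the old energy
    ([block1_error_le], [block2_error_le]), so the iterates are bounded and
    converge along an ultrafilter finer than the neighbourhoods of infinity
    ([pd_ultra_cvg]). The dissipation tends to 0 ([descent_cvg]), so the
    optimality conditions of the subproblems become in the limit those of the
    problem, the subdifferential of a lower semicontinuous function being closed:
    the limit along the ultrafilter is again a KKT point ([bcd_limit_kkt]).
    Finally the descent may be measured from this new KKT point; the energy is
    then nonincreasing and tends to 0 along the ultrafilter, hence tends to 0, and
    since it bounds the errors the whole sequence converges. KKT points are
    minimizers by convexity ([kkt_argmin]). *)

Import Order.TTheory GRing.Theory Num.Theory.
Import numFieldNormedType.Exports.
Local Open Scope classical_set_scope.
Local Open Scope ring_scope.

Set Implicit Arguments.
Unset Strict Implicit.
Unset Printing Implicit Defensive.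

(** * Inner products and quadratic forms *)

Lemma dotvC (R : realType) n (u v : 'cV[R]_n) : dotv u v = dotv v u.
Proof.
by rewrite /dotv !mxE; apply: eq_bigr => i _; rewrite !mxE mulrC.
Qed.

Lemma dotvDl (R : realType) n (u v w : 'cV[R]_n) :
  dotv (u + v) w = dotv u w + dotv v w.
Proof. by rewrite /dotv linearD /= mulmxDl mxE. Qed.

Lemma dotvDr (R : realType) n (u v w : 'cV[R]_n) :
  dotv w (u + v) = dotv w u + dotv w v.
Proof. by rewrite /dotv mulmxDr mxE. Qed.

Lemma dotvNr (R : realType) n (u w : 'cV[R]_n) : dotv w (- u) = - dotv w u.
Proof. by rewrite /dotv mulmxN mxE. Qed.

Lemma dotvNl (R : realType) n (u w : 'cV[R]_n) : dotv (- u) w = - dotv u w.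
Proof. by rewrite !(dotvC _ w) dotvNr. Qed.

Lemma dotvZr (R : realType) n c (u w : 'cV[R]_n) :
  dotv w (c *: u) = c * dotv w u.
Proof. by rewrite /dotv -scalemxAr mxE. Qed.

Lemma dotvZl (R : realType) n c (u w : 'cV[R]_n) :
  dotv (c *: u) w = c * dotv u w.
Proof. by rewrite !(dotvC _ w) dotvZr. Qed.

Lemma dotv0r (R : realType) n (u : 'cV[R]_n) : dotv u 0 = 0.
Proof. by rewrite /dotv mulmx0 mxE. Qed.

Lemma dotv_mulmxl (R : realType) m n (A : 'M[R]_(m, n)) u v :
  dotv (A *m u) v = dotv u (A^T *m v).
Proof. by rewrite /dotv trmx_mul mulmxA. Qed.

Definition dotvE := (dotvDl, dotvDr, dotvNl, dotvNr, dotvZl, dotvZr).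

Lemma dotv_col_mx (R : realType) m n (u1 v1 : 'cV[R]_m) (u2 v2 : 'cV[R]_n) :
  dotv (col_mx u1 u2) (col_mx v1 v2) = dotv u1 v1 + dotv u2 v2.
Proof. by rewrite /dotv tr_col_mx mul_row_col mxE. Qed.

Lemma sqnormE (R : realType) n (G : 'M[R]_n) v : sqnorm G v = dotv v (G *m v).
Proof. by rewrite /sqnorm /dotv mulmxA. Qed.

Lemma sqnorm0 (R : realType) n (G : 'M[R]_n) : sqnorm G 0 = 0.
Proof. by rewrite sqnormE mulmx0 dotv0r. Qed.

Lemma sqnormDmx (R : realType) n (G K : 'M[R]_n) v :
  sqnorm (G + K) v = sqnorm G v + sqnorm K v.
Proof. by rewrite !sqnormE mulmxDl dotvDr. Qed.

Lemma sqnormD (R : realType) n (G : 'M[R]_n) u v : G^T = G ->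
  sqnorm G (u + v) = sqnorm G u + 2 * dotv u (G *m v) + sqnorm G v.
Proof.
move=> Gs; rewrite !sqnormE mulmxDr !dotvE.
by rewrite (dotvC v (G *m u)) dotv_mulmxl Gs; ring.
Qed.

Lemma sqnormZ (R : realType) n (G : 'M[R]_n) c v :
  sqnorm G (c *: v) = c ^+ 2 * sqnorm G v.
Proof. by rewrite !sqnormE -scalemxAr !dotvE; ring. Qed.

Lemma sqnormN (R : realType) n (G : 'M[R]_n) v : sqnorm G (- v) = sqnorm G v.
Proof. by rewrite !sqnormE mulmxN !dotvE opprK. Qed.

Lemma psd_sqnormD_le (R : realType) n (G : 'M[R]_n) u v : psdmx G ->
  sqnorm G (u + v) <= 2 * sqnorm G u + 2 * sqnorm G v.
Proof.
move=> [Gs G0]; have := G0 (u - v).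
by rewrite !sqnormD // mulmxN dotvNr sqnormN; lra.
Qed.

(** Positivity of the quadratic form at [s u + t v], for suitable [s] and [t]. *)
Lemma psd_cauchy_schwarz (R : realType) n (G : 'M[R]_n) u v : psdmx G ->
  dotv u (G *m v) ^+ 2 <= sqnorm G u * sqnorm G v.
Proof.
move=> [Gs G0].
have pol s t : 0 <= s ^+ 2 * sqnorm G u + 2 * s * t * dotv u (G *m v)
    + t ^+ 2 * sqnorm G v.
  have := G0 (s *: u + t *: v).
  rewrite sqnormD // !sqnormZ -scalemxAr !dotvE; lra.
set b := dotv u _ in pol *; set a := sqnorm G u in pol *.
set c := sqnorm G v in pol *.
have a0 : 0 <= a by exact: G0.
have c0 : 0 <= c by exact: G0.
have [az|an0] := eqVneq a 0; last first.
  have {}a0 : 0 < a by rewrite lt_def a0 andbT.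
  have := pol b (- a); rewrite -subr_ge0 => h.
  have : 0 <= a * (a * c - b ^+ 2) by nra.
  by rewrite pmulr_rge0 // subr_ge0.
(* the form is now affine in s and nonnegative, which forces b = 0; otherwise
   this s makes it negative *)
rewrite az mul0r; have [->|b0] := eqVneq b 0; first by rewrite expr0n.
have := pol (- (c + 1) / b) 1.
have -> : (- (c + 1) / b) ^+ 2 * a + 2 * (- (c + 1) / b) * 1 * b + 1 ^+ 2 * c
  = (- (c + 1) / b) ^+ 2 * a - c - 2 by field.
by rewrite az; lra.
Qed.

(** A nonzero vector in the kernel would have zero squared norm. *)
Lemma pdmx_unit (R : realType) n (G : 'M[R]_n) : pdmx G -> G \in unitmx.
Proof.
move=> [Gs Gp]; rewrite -row_free_unit -kermx_eq0; apply/eqP/row_matrixP => i.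
rewrite row0; apply/eqP/negPn/negP => k0.
have := Gp (row i (kermx G))^T; rewrite trmx_eq0 => /(_ k0).
by rewrite /sqnorm trmxK -row_mul mulmx_ker row0 mul0mx mxE ltxx.
Qed.

Lemma pd_psd (R : realType) n (G : 'M[R]_n) : pdmx G -> psdmx G.
Proof.
move=> [Gs Gp]; split=> // v.
have [->|v0] := eqVneq v 0; last exact: ltW (Gp _ v0).
by rewrite sqnorm0.
Qed.

(** Cauchy-Schwarz against a basis vector: the seminorm of [v] controls [G v] even
    when [G] is singular and [v] itself is not controlled. *)
Lemma psd_coord_le (R : realType) n (G : 'M[R]_n) v i : psdmx G ->
  (G *m v) i 0 ^+ 2 <= G i i * sqnorm G v.
Proof.
move=> Gpsd; have := psd_cauchy_schwarz (delta_mx i 0) v Gpsd.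
rewrite /dotv trmx_delta -rowE [X in X ^+ 2]mxE.
by rewrite sqnormE /dotv trmx_delta -rowE -colE !mxE.
Qed.

(** * Convergence of vectors controlled by a quadratic form *)

Lemma cvg_mxP (R : realType) T (F : set_system T) {FF : Filter F} m n
    (f : T -> 'M[R]_(m, n)) (M : 'M[R]_(m, n)) :
  f @ F --> M <-> (forall i j, f t i j @[t --> F] --> M i j).
Proof.
split=> [fM i j|fM].
  exact: cvg_comp fM (@coord_continuous R m n i j M).
apply/cvg_mx_entourageP => A entA; near=> N.
move=> i j; rewrite inE; move: i j.
near: N; apply: filter_forall => i; apply: filter_forall => j.
by have /cvg_app_entourageP/(_ A entA) := fM i j.
Unshelve. all: by end_near. Qed.

Lemma cvg_mulmx (R : realType) T (F : set_system T) {FF : Filter F} m n p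
    (f : T -> 'M[R]_(m, n)) (g : T -> 'M[R]_(n, p))
    (A : 'M[R]_(m, n)) (B : 'M[R]_(n, p)) :
  f @ F --> A -> g @ F --> B -> f t *m g t @[t --> F] --> A *m B.
Proof.
move=> /cvg_mxP fA /cvg_mxP gB; apply/cvg_mxP => i j.
rewrite mxE; under eq_fun do rewrite mxE.
apply: cvg_big => [|k _]; last by apply: cvgM.
exact: add_continuous.
Qed.

Lemma cvg_dotv (R : realType) T (F : set_system T) {FF : Filter F} n
    (f g : T -> 'cV[R]_n) (u v : 'cV[R]_n) :
  f @ F --> u -> g @ F --> v -> dotv (f t) (g t) @[t --> F] --> dotv u v.
Proof.
move=> fu gv.
have : (f t)^T *m g t @[t --> F] --> u^T *m v.
  apply: cvg_mulmx => //; apply/cvg_mxP => i j.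
  by rewrite mxE; under eq_fun do rewrite mxE; move/cvg_mxP: fu; apply.
by move/cvg_mxP; apply.
Qed.

Lemma cvg_sqnormB (R : realType) T (F : set_system T) {FF : Filter F} n
    (G : 'M[R]_n) (f : T -> 'cV[R]_n) (u : 'cV[R]_n) :
  f @ F --> u -> sqnorm G (f t - u) @[t --> F] --> 0.
Proof.
move=> fu; rewrite -(sqnorm0 G) -(subrr u) sqnormE.
under eq_fun do rewrite sqnormE.
have fu' : f t - u @[t --> F] --> u - u by apply: cvgB => //; exact: cvg_cst.
by apply: cvg_dotv => //; apply: cvg_mulmx => //; exact: cvg_cst.
Qed.

Lemma cvg_col_mx (R : realType) T (F : set_system T) {FF : Filter F} d1 d2
    (u : T -> 'cV[R]_d1) (v : T -> 'cV[R]_d2) (p : 'cV[R]_d1) (q : 'cV[R]_d2) :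
  u @ F --> p -> v @ F --> q -> col_mx (u t) (v t) @[t --> F] --> col_mx p q.
Proof.
move=> /cvg_mxP up /cvg_mxP vq; apply/cvg_mxP => i j.
case: (split_ordP i) => k ->.
  by rewrite col_mxEu; under eq_fun do rewrite col_mxEu; exact: up.
by rewrite col_mxEd; under eq_fun do rewrite col_mxEd; exact: vq.
Qed.

Lemma dominated_cvg0 (R : realType) T (F : set_system T) {FF : Filter F}
    (c : R) (f g : T -> R) :
  (forall t, 0 <= f t <= c * g t) -> g @ F --> (0 : R) -> f @ F --> (0 : R).
Proof.
move=> fg g0; apply: (@squeeze_cvgr _ _ _ _ (fun=> 0) (fun t => c * g t)).
- exact: nearW.
- exact: cvg_cst.
- by rewrite -(mulr0 c); apply: cvgM => //; exact: cvg_cst.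
Qed.

Lemma psd_cvg0 (R : realType) T (F : set_system T) {FF : Filter F} n
    (G : 'M[R]_n) (v : T -> 'cV[R]_n) : psdmx G ->
  sqnorm G (v t) @[t --> F] --> 0 -> G *m v t @[t --> F] --> (0 : 'cV[R]_n).
Proof.
move=> Gpsd v0; apply/cvg_mxP => i j; rewrite ord1 [in X in _ --> X]mxE.
have s0 : Num.sqrt (G i i * sqnorm G (v t)) @[t --> F] --> 0.
  rewrite -[X in _ --> X](@sqrtr0 R) -(mulr0 (G i i)).
  apply: continuous_cvg; first exact: sqrt_continuous.
  by apply: cvgM => //; exact: cvg_cst.
apply: norm_cvg0; apply: squeeze_cvgr s0; last exact: cvg_cst.
near=> t; rewrite normr_ge0 /= -sqrtr_sqr ler_wsqrtr //.
exact: psd_coord_le.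
Unshelve. all: by end_near. Qed.

(** [v = G^-1 (G v)] turns the control of [G v] into a control of [v]. *)
Lemma pd_cvg (R : realType) T (F : set_system T) {FF : Filter F} n
    (G : 'M[R]_n) (v : T -> 'cV[R]_n) (p : 'cV[R]_n) : pdmx G ->
  sqnorm G (v t - p) @[t --> F] --> 0 -> v @ F --> p.
Proof.
move=> Gpd /(psd_cvg0 (pd_psd Gpd)) Gv.
have -> : v = (fun t => p + invmx G *m (G *m (v t - p))).
  by apply/funext => t; rewrite mulKmx ?pdmx_unit // addrC subrK.
rewrite -[X in _ --> X]addr0 -(mulmx0 _ (invmx G)).
by apply: cvgD; [exact: cvg_cst|apply: cvg_mulmx => //; exact: cvg_cst].
Qed.

(** A cluster point of an ultrafilter is a limit. *)
Lemma ultra_bounded_cvg (R : realType) T (U : set_system T) {UU : UltraFilter U}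
    (f : T -> R) M : (forall t, `|f t| <= M) -> exists l : R, f @ U --> l.
Proof.
move=> fM; have PU : ProperFilter U by exact: ultra_proper.
have [|l [_ cl]] := @segment_compact R (- M) M (f @ U) _.
  by apply: nearW => t /=; rewrite in_itv /= -ler_norml.
exists l => A lA; have [//|UA] := in_ultra_setVsetC (f @^-1` A) UU.
by have [t []] := cl (~` A) A UA lA.
Qed.

(** Bolzano-Weierstrass in the norm of [G]. An ultrafilter replaces the extraction
    of a subsequence: one filter serves all coordinates and both blocks at once. *)
Lemma pd_ultra_cvg (R : realType) T (U : set_system T) {UU : UltraFilter U} n
    (G : 'M[R]_n) (v : T -> 'cV[R]_n) (p : 'cV[R]_n) M : pdmx G ->
  (forall t, sqnorm G (v t - p) <= M) -> exists q : 'cV[R]_n, v @ U --> q.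
Proof.
move=> Gpd vM; have PU : ProperFilter U by exact: ultra_proper.
have Gpsd := pd_psd Gpd.
have /choice[l lP] i : exists li : R, (G *m (v t - p)) i 0 @[t --> U] --> li.
  apply: (@ultra_bounded_cvg _ _ _ _ _ (Num.sqrt (G i i * M))) => t.
  rewrite -sqrtr_sqr ler_wsqrtr //.
  apply: le_trans (psd_coord_le _ _ Gpsd) _; rewrite ler_wpM2l //.
  have := Gpsd.2 (delta_mx i 0).
  by rewrite sqnormE /dotv trmx_delta -rowE -colE !mxE.
have Gv : G *m (v t - p) @[t --> U] --> \col_i l i.
  by apply/cvg_mxP => i j; rewrite ord1 mxE.
exists (p + invmx G *m \col_i l i).
have -> : v = (fun t => p + invmx G *m (G *m (v t - p))).
  by apply/funext => t; rewrite mulKmx ?pdmx_unit // addrC subrK.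
by apply: cvgD; [exact: cvg_cst|apply: cvg_mulmx => //; exact: cvg_cst].
Qed.

(** * Subdifferentials and optimality *)

Lemma subdiff_dom (R : realType) n (f : 'cV[R]_n -> \bar R) x w :
  proper_fun f -> subdiff f x w -> dom f x.
Proof.
move=> [fNy [y fy]] /(_ y) /le_lt_trans/(_ fy); rewrite /dom /=.
by case: (f x) => [r| |]; rewrite ?ltry ?addye.
Qed.

(** If the subgradient inequality failed at the limit, lower semicontinuity would
    provide a real [a] below [f (x t)] for all late [t] that still violates it in
    place of [f p]; but the inequality at [x t] passes to the limit with [a]. *)
Lemma subdiff_closed (R : realType) n (f : 'cV[R]_n -> \bar R)
    T (F : set_system T) {FF : ProperFilter F} (x w : T -> 'cV[R]_n)
    (p q : 'cV[R]_n) :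
  lower_semicontinuous f -> (forall y, (-oo < f y)%E) ->
  (forall t, subdiff f (x t) (w t)) -> x @ F --> p -> w @ F --> q ->
  subdiff f p q.
Proof.
move=> flsc fNy fw xp wq y.
case fyE : (f y) (fNy y) => [r| |] // _; last by rewrite leey.
rewrite leNgt; apply/negP => lt_r.
have {lt_r} [a ra /flsc[V pV Va]] :
    exists2 a : R, r < a + dotv q (y - p) & (a%:E < f p)%E.
  move: lt_r (fNy p); case: (f p) => [s| |] // + _.
    rewrite -EFinD lte_fin => lt_r.
    exists (2^-1 * (s + (r - dotv q (y - p)))); rewrite ?lte_fin; lra.
  by move=> _; exists (r - dotv q (y - p) + 1); rewrite ?ltry //; lra.
suff : a + dotv q (y - p) <= r by rewrite leNgt ra.
have lim : a + dotv (w t) (y - x t) @[t --> F] --> a + dotv q (y - p).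
  apply: cvgD; first exact: cvg_cst.
  by apply: cvg_dotv => //; apply: cvgB => //; exact: cvg_cst.
apply: cvgr_to_le lim _; have Vx : \forall t \near F, V (x t) by exact: xp.
apply: filterS Vx => t /Va aft; have := fw t y; rewrite fyE.
case: (f (x t)) aft => [s| |] //; rewrite -?EFinD ?lee_fin ?lte_fin; lra.
Qed.

(** First-order optimality for a convex function plus a function that is quadratic
    along lines with gradient [l] at [x]: compare [x] with [x + t (y - x)],
    divide by [t] and let [t] tend to 0. *)
Lemma argmin_subdiff (R : realType) n (f : 'cV[R]_n -> \bar R)
    (h : 'cV[R]_n -> R) x l :
  proper_fun f -> convex_efun f ->
  (forall d, exists c, forall t,
     h (x + t *: d) = h x + t * dotv l d + t ^+ 2 * c) ->
  argmin (fun y => (f y + (h y)%:E)%E) x -> subdiff f x (- l).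
Proof.
move=> [fNy [y0 fy0]] fcvx hquad xmin.
have [fx fxE] : exists r, f x = r%:E.
  have := xmin y0; move: fy0 (fNy x) (fNy y0); rewrite /dom /=.
  by case: (f y0) => // r0; case: (f x) => // r; exists r.
move=> y; case fyE : (f y) (fNy y) => [fy| |] // _; last by rewrite leey.
rewrite fxE -EFinD lee_fin dotvNl.
have [c hc] := hquad (y - x).
have key t : 0 < t -> t < 1 -> 0 <= fy - fx + dotv l (y - x) + t * c.
  move=> t0 t1; have := xmin (t *: y + (1 - t) *: x).
  have -> : t *: y + (1 - t) *: x = x + t *: (y - x).
    by rewrite scalerBl scalerBr scale1r addrCA addrC -!addrA [- _ + _]addrC.
  have := fcvx y x t t0 t1.
  have -> : t *: y + (1 - t) *: x = x + t *: (y - x).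
    by rewrite scalerBl scalerBr scale1r addrCA addrC -!addrA [- _ + _]addrC.
  rewrite fyE fxE hc -!EFinM -!EFinD.
  case: (f _) (fNy (x + t *: (y - x))) => [s| |] // _.
  rewrite -!EFinD !lee_fin => sle lex.
  rewrite -(pmulr_rge0 _ t0); nra.
rewrite lerBlDr -subr_ge0; set s := fy - fx + _ in key.
suff : 0 <= s by rewrite /s; lra.
apply/ler_addgt0Pr => e e0.
(* t makes t c at most e *)
pose t := Num.min (2^-1) (e / (`|c| + 1)).
have c1 : 0 < `|c| + 1 by rewrite ltr_wpDl.
have t0 : 0 < t by rewrite lt_min invr_gt0 ltr0n divr_gt0.
have t1 : t < 1 by rewrite gt_min; apply/orP; left; lra.
have te : t * (`|c| + 1) <= e by rewrite -ler_pdivlMr // ge_min lexx orbT.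
by have := key t t0 t1; have := ler_norm c; nra.
Qed.

(** The gradient of the smooth part of a block subproblem at its minimizer is the
    opposite of a subgradient. *)
Lemma prox_quadratic_subdiff (R : realType) n (f : 'cV[R]_n -> \bar R)
    (A P : 'M[R]_n) (b g xk x : 'cV[R]_n) :
  proper_fun f -> convex_efun f -> A^T = A -> P^T = P ->
  argmin (fun y => (f y + (2^-1 * sqnorm A y + dotv y b + dotv g y
                           + 2^-1 * sqnorm P (y - xk))%:E)%E) x ->
  subdiff f x (- (A *m x + b + g + P *m (x - xk))).
Proof.
move=> fp fc As Ps; apply: argmin_subdiff => // d.
exists (2^-1 * (sqnorm A d + sqnorm P d)) => t.
rewrite (_ : x + t *: d - xk = (x - xk) + t *: d); last by rewrite addrAC.
move: (x - xk) => r.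
rewrite !sqnormD // !sqnormZ -!scalemxAr !dotvE !dotv_mulmxl As Ps (dotvC b).
lra.
Qed.

(** The two subgradient inequalities add up, and the quadratic term lies above its
    tangent at [x]. *)
Lemma kkt_argmin (R : realType) d1 d2 (f1 : 'cV[R]_d1 -> \bar R)
    (f2 : 'cV[R]_d2 -> \bar R) (H : 'M[R]_(d1 + d2)) g x :
  psdmx H -> kkt_point f1 f2 H g x -> argmin (objective f1 f2 H g) x.
Proof.
move=> [Hs H0] [k1 k2] y; rewrite /objective.
apply: le_trans _ (leeD2r _ (leeD (k1 (usubmx y)) (k2 (dsubmx y)))).
rewrite [in leRHS]addeACA -[leRHS]addeA; apply: leeD2l; rewrite -EFinD lee_fin.
have -> : dotv (usubmx (- (H *m x + g))) (usubmx y - usubmx x)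
    + dotv (dsubmx (- (H *m x + g))) (dsubmx y - dsubmx x)
    = - (dotv (y - x) (H *m x) + dotv g (y - x)).
  by rewrite -!linearB /= -dotv_col_mx !vsubmxK dotvNl (dotvC (y - x)) -dotvDl.
have := sqnormD (y - x) x Hs; rewrite subrK => ->.
by have := H0 (y - x); rewrite dotvDr dotvNr; lra.
Qed.

(** * Energy and dissipation of one step *)

Lemma dlsubmx_sym (R : realType) d1 d2 (H : 'M[R]_(d1 + d2)) :
  H^T = H -> dlsubmx H = (ursubmx H)^T.
Proof. by move=> Hs; rewrite trmx_ursub Hs. Qed.

Lemma psd_drsubmx (R : realType) d1 d2 (H : 'M[R]_(d1 + d2)) :
  psdmx H -> psdmx (drsubmx H).
Proof.
move=> [Hs H0]; split=> [|v]; first by rewrite trmx_drsub Hs.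
have := H0 (col_mx 0 v); rewrite -{1}(submxK H) !sqnormE mul_block_col.
by rewrite dotv_col_mx !mulmx0 !add0r /dotv trmx0 mul0mx mxE add0r.
Qed.

Lemma mulmx_sym_col (R : realType) d1 d2 (H : 'M[R]_(d1 + d2))
    (a : 'cV[R]_d1) (b : 'cV[R]_d2) : H^T = H ->
  H *m col_mx a b = col_mx (ulsubmx H *m a + ursubmx H *m b)
                           ((ursubmx H)^T *m a + drsubmx H *m b).
Proof. by move=> Hs; rewrite -{1}(submxK H) mul_block_col dlsubmx_sym. Qed.

Lemma sqnorm_sym_col (R : realType) d1 d2 (H : 'M[R]_(d1 + d2))
    (a : 'cV[R]_d1) (b : 'cV[R]_d2) : H^T = H ->
  sqnorm H (col_mx a b) =
    sqnorm (ulsubmx H) a + 2 * dotv a (ursubmx H *m b) + sqnorm (drsubmx H) b.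
Proof.
move=> Hs; rewrite !sqnormE mulmx_sym_col // dotv_col_mx !dotvE.
by rewrite (dotvC b (_^T *m a)) dotv_mulmxl trmxK; ring.
Qed.

(** The Lyapunov function: [a] and [b] stand for the errors of the two blocks. No
    term in [H11] occurs, because the first block is overwritten before its old
    value is used except in the proximal term. *)
Definition energy (R : realType) d1 d2 (H : 'M[R]_(d1 + d2)) (R1 : 'M[R]_d1)
    (R2 : 'M[R]_d2)
    (a : 'cV[R]_d1) (b : 'cV[R]_d2) : R :=
  sqnorm R1 a + sqnorm (drsubmx H) b + sqnorm R2 b.

(** A lower bound for the energy lost by one step, from the errors [a0], [b0] to the
    errors [a], [b]. *)
Definition dissipation (R : realType) d1 d2 (H : 'M[R]_(d1 + d2))
    (S1 R1 : 'M[R]_d1) (S2 R2 : 'M[R]_d2)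
    (a0 : 'cV[R]_d1) (b0 : 'cV[R]_d2) (a : 'cV[R]_d1) (b : 'cV[R]_d2) : R :=
  sqnorm H (col_mx a b) + sqnorm H (col_mx a b0)
  + 2 * sqnorm S1 a + 2 * sqnorm S2 b
  + sqnorm R1 (a - a0) + sqnorm R2 (b - b0).

Lemma energy_ge0 (R : realType) d1 d2 (H : 'M[R]_(d1 + d2))
    (R1 : 'M[R]_d1) (R2 : 'M[R]_d2)
    (a : 'cV[R]_d1) (b : 'cV[R]_d2) :
  psdmx H -> psdmx R1 -> psdmx R2 -> 0 <= energy H R1 R2 a b.
Proof.
by move=> /psd_drsubmx[_ H0] [_ R10] [_ R20]; rewrite !addr_ge0.
Qed.

Lemma dissipation_ge0 (R : realType) d1 d2 (H : 'M[R]_(d1 + d2))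
    (S1 R1 : 'M[R]_d1) (S2 R2 : 'M[R]_d2)
    (a0 : 'cV[R]_d1) (b0 : 'cV[R]_d2) (a : 'cV[R]_d1) (b : 'cV[R]_d2) :
  psdmx H -> psdmx S1 -> psdmx S2 -> psdmx R1 -> psdmx R2 ->
  0 <= dissipation H S1 R1 S2 R2 a0 b0 a b.
Proof.
by move=> [_ H0] [_ S10] [_ S20] [_ R10] [_ R20];
   rewrite !addr_ge0 // mulr_ge0.
Qed.

(** The hypotheses are the monotonicity inequalities at the new iterates. Twice
    their sum gives the claim, by
[[
2 (a'H11 a + a'H12 b0 + a'H12 b + b'H22 b)
  = |(a,b)|_H^2 + |(a,b0)|_H^2 + |b|_H22^2 - |b0|_H22^2
]]
    and by [2 a'R(a - a0) = |a|_R^2 - |a0|_R^2 + |a - a0|_R^2] for the two proximal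
    terms. *)
Lemma energy_descent (R : realType) d1 d2 (H : 'M[R]_(d1 + d2))
    (S1 R1 : 'M[R]_d1) (S2 R2 : 'M[R]_d2)
    (a0 : 'cV[R]_d1) (b0 : 'cV[R]_d2) (a : 'cV[R]_d1) (b : 'cV[R]_d2) :
  H^T = H -> R1^T = R1 -> R2^T = R2 ->
  sqnorm S1 a <=
    dotv a (- (ulsubmx H *m a + ursubmx H *m b0 + R1 *m (a - a0))) ->
  sqnorm S2 b <=
    dotv b (- ((ursubmx H)^T *m a + drsubmx H *m b + R2 *m (b - b0))) ->
  energy H R1 R2 a b + dissipation H S1 R1 S2 R2 a0 b0 a b
    <= energy H R1 R2 a0 b0.
Proof.
move=> Hs R1s R2s; rewrite !dotvE.
rewrite -!sqnormE (dotvC b (_^T *m a)) dotv_mulmxl trmxK.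
have e1 := sqnormD (- (a - a0)) a R1s; have e2 := sqnormD (- (b - b0)) b R2s.
rewrite /energy /dissipation !sqnorm_sym_col //.
move: e1 e2; rewrite !sqnormN !opprB !subrK !(dotvC (_ - _)).
rewrite !dotv_mulmxl R1s R2s !mulmxBr !dotvE; lra.
Qed.

Lemma block2_error_le (R : realType) d1 d2 (H : 'M[R]_(d1 + d2))
    (S1 R1 : 'M[R]_d1) (S2 R2 : 'M[R]_d2)
    (a0 : 'cV[R]_d1) (b0 : 'cV[R]_d2) (a : 'cV[R]_d1) (b : 'cV[R]_d2) :
  psdmx H -> psdmx S1 -> psdmx S2 -> psdmx R1 -> psdmx R2 ->
  sqnorm (drsubmx H + S2 + R2) b <=
    energy H R1 R2 a b + dissipation H S1 R1 S2 R2 a0 b0 a b.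
Proof.
move=> [_ H0] [_ S10] [_ S20] [_ R10] [_ R20].
rewrite !sqnormDmx /energy /dissipation.
have := H0 (col_mx a b); have := H0 (col_mx a b0); have := S10 a.
have := S20 b; have := R10 a; have := R10 (a - a0); have := R20 (b - b0).
lra.
Qed.

(** The energy misses [H11]; that part of the norm is recovered from the
    [H]-seminorm of the joint error, which the dissipation contains, and from the
    error of the second block. *)
Lemma block1_error_le (R : realType) d1 d2 (H : 'M[R]_(d1 + d2))
    (S1 R1 : 'M[R]_d1) (S2 R2 : 'M[R]_d2)
    (a0 : 'cV[R]_d1) (b0 : 'cV[R]_d2) (a : 'cV[R]_d1) (b : 'cV[R]_d2) :
  psdmx H -> psdmx S1 -> psdmx S2 -> psdmx R1 -> psdmx R2 ->
  sqnorm (ulsubmx H + S1 + R1) a <=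
    3 * (energy H R1 R2 a b + dissipation H S1 R1 S2 R2 a0 b0 a b).
Proof.
move=> Hpsd [_ S10] [_ S20] [_ R10] [_ R20].
(* the block a is the joint error minus the block b *)
have := psd_sqnormD_le (col_mx a b) (- col_mx 0 b) Hpsd.
rewrite opp_col_mx oppr0 add_col_mx addr0 subrr => h.
have [_ H220] := psd_drsubmx Hpsd; case: Hpsd => Hs H0; move: h.
rewrite !sqnormDmx /energy /dissipation.
have := H0 (col_mx a b); have := H0 (col_mx a b0); have := S10 a.
have := S20 b; have := R10 a; have := R10 (a - a0); have := R20 (b - b0).
have := H220 b; have := R20 b.
rewrite (sqnorm_sym_col a 0) // (sqnorm_sym_col 0 (- b)) // !sqnormN.
rewrite mulmx0 !sqnorm0 dotv0r (dotvC 0) dotv0r; lra.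
Qed.

(** The second block moves little in [H]-seminorm because [(0, b - b0)] is the
    difference of the two vectors whose [H]-seminorms the dissipation contains. *)
Lemma dissipation_bounds (R : realType) d1 d2 (H : 'M[R]_(d1 + d2))
    (S1 R1 : 'M[R]_d1) (S2 R2 : 'M[R]_d2)
    (a0 : 'cV[R]_d1) (b0 : 'cV[R]_d2) (a : 'cV[R]_d1) (b : 'cV[R]_d2) :
  psdmx H -> psdmx S1 -> psdmx S2 -> psdmx R1 -> psdmx R2 ->
  let D := dissipation H S1 R1 S2 R2 a0 b0 a b in
  [/\ sqnorm R1 (a - a0) <= 2 * D, sqnorm R2 (b - b0) <= 2 * D
    & sqnorm H (col_mx 0 (b - b0)) <= 2 * D].
Proof.
move=> Hpsd [_ S10] [_ S20] [_ R10] [_ R20] D.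
have := psd_sqnormD_le (col_mx a b) (- col_mx a b0) Hpsd.
rewrite opp_col_mx add_col_mx subrr -opp_col_mx sqnormN.
case: Hpsd => _ H0; rewrite /D /dissipation.
have := H0 (col_mx a b); have := H0 (col_mx a b0); have := S10 a.
have := S20 b; have := R10 (a - a0); have := R20 (b - b0).
by split; lra.
Qed.

(** The iterates themselves need not satisfy [a - a0 -> 0] at this stage: [R1],
    [R2] and [H] may be singular, and only the images of the steps are
    controlled. *)
Lemma dissipation_cvg0 (R : realType) T (F : set_system T) {FF : Filter F}
    d1 d2 (H : 'M[R]_(d1 + d2)) (S1 R1 : 'M[R]_d1) (S2 R2 : 'M[R]_d2)
    (a0 a : T -> 'cV[R]_d1) (b0 b : T -> 'cV[R]_d2) :
  psdmx H -> psdmx S1 -> psdmx S2 -> psdmx R1 -> psdmx R2 ->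
  dissipation H S1 R1 S2 R2 (a0 t) (b0 t) (a t) (b t) @[t --> F] --> 0 ->
  [/\ R1 *m (a t - a0 t) @[t --> F] --> (0 : 'cV[R]_d1),
      R2 *m (b t - b0 t) @[t --> F] --> (0 : 'cV[R]_d2)
    & ursubmx H *m (b t - b0 t) @[t --> F] --> (0 : 'cV[R]_d1)].
Proof.
move=> Hpsd S1psd S2psd R1psd R2psd D0.
have bounds t := dissipation_bounds (a0 t) (b0 t) (a t) (b t)
  Hpsd S1psd S2psd R1psd R2psd.
split.
- apply: (psd_cvg0 R1psd); apply: (dominated_cvg0 (c := 2)) D0 => t.
  by rewrite R1psd.2; have [] := bounds t.
- apply: (psd_cvg0 R2psd); apply: (dominated_cvg0 (c := 2)) D0 => t.
  by rewrite R2psd.2; have [] := bounds t.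
have : H *m col_mx 0 (b t - b0 t) @[t --> F] --> (0 : 'cV[R]_(d1 + d2)).
  apply: (psd_cvg0 Hpsd); apply: (dominated_cvg0 (c := 2)) D0 => t.
  by rewrite Hpsd.2; have [] := bounds t.
move=> /cvg_mxP HD; apply/cvg_mxP => i j; move: (HD (lshift d2 i) j).
rewrite !mxE; have [Hs _] := Hpsd.
by under eq_fun do rewrite mulmx_sym_col // col_mxEu mulmx0 add0r.
Qed.

Lemma descent_cvg (R : realType) (E D : nat -> R) :
  (forall k, 0 <= E k) -> (forall k, 0 <= D k) ->
  (forall k, E k.+1 + D k <= E k) ->
  (exists l : R, E @ \oo --> l) /\ D @ \oo --> (0 : R).
Proof.
move=> E0 D0 ED.
have /cvg_ex[l El] : cvgn E.
  apply: nonincreasing_is_cvgn; last by exists 0 => _ [k _ <-].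
  apply/nonincreasing_seqP => k.
  by have := ED k; have := D0 k; lra.
split; first by exists l.
have El1 : E k.+1 @[k --> \oo] --> l by rewrite (cvg_shiftS E).
apply: (@squeeze_cvgr _ _ _ _ (fun=> 0) (fun k => E k - E k.+1)).
- by near=> k; rewrite D0 /=; have := ED k; lra.
- exact: cvg_cst.
- by rewrite -(subrr l); apply: cvgB.
Unshelve. all: by end_near. Qed.

(** * Convergence of the method *)

Lemma bcd_subdiff (R : realType) d1 d2 (f1 : 'cV[R]_d1 -> \bar R)
    (f2 : 'cV[R]_d2 -> \bar R) (H : 'M[R]_(d1 + d2)) (g : 'cV[R]_(d1 + d2))
    (R1 : 'M[R]_d1) (R2 : 'M[R]_d2) x1 x2 k :
  closed_proper_convex f1 -> closed_proper_convex f2 ->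
  H^T = H -> R1^T = R1 -> R2^T = R2 ->
  cyclic_prox_bcd f1 f2 H g R1 R2 x1 x2 ->
  subdiff f1 (x1 k.+1) (- (ulsubmx H *m x1 k.+1 + ursubmx H *m x2 k
                           + usubmx g + R1 *m (x1 k.+1 - x1 k))) /\
  subdiff f2 (x2 k.+1) (- ((ursubmx H)^T *m x1 k.+1 + drsubmx H *m x2 k.+1
                           + dsubmx g + R2 *m (x2 k.+1 - x2 k))).
Proof.
move=> [_ p1 c1] [_ p2 c2] Hs R1s R2s /(_ k)[min1 min2]; split.
  by apply: prox_quadratic_subdiff min1; rewrite // trmx_ulsub Hs.
rewrite [_ *m _ + _]addrC; apply: prox_quadratic_subdiff => //.
  by rewrite trmx_drsub Hs.
by under eq_fun do rewrite (dotvC _ (_^T *m _)) dotv_mulmxl trmxK.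
Qed.

(** Monotonicity of the subdifferentials, between the subgradients produced by the
    step and those given by the KKT point, feeds the algebraic descent lemma. *)
Lemma bcd_energy_descent (R : realType) d1 d2 (f1 : 'cV[R]_d1 -> \bar R)
    (f2 : 'cV[R]_d2 -> \bar R) (H : 'M[R]_(d1 + d2)) (g : 'cV[R]_(d1 + d2))
    (S1 R1 : 'M[R]_d1) (S2 R2 : 'M[R]_d2) x1 x2 (p1 : 'cV[R]_d1)
    (p2 : 'cV[R]_d2) k :
  closed_proper_convex f1 -> closed_proper_convex f2 ->
  H^T = H -> R1^T = R1 -> R2^T = R2 ->
  strong_monotone_subdiff f1 S1 -> strong_monotone_subdiff f2 S2 ->
  cyclic_prox_bcd f1 f2 H g R1 R2 x1 x2 ->
  kkt_point f1 f2 H g (col_mx p1 p2) ->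
  energy H R1 R2 (x1 k.+1 - p1) (x2 k.+1 - p2)
  + dissipation H S1 R1 S2 R2 (x1 k - p1) (x2 k - p2)
                              (x1 k.+1 - p1) (x2 k.+1 - p2)
  <= energy H R1 R2 (x1 k - p1) (x2 k - p2).
Proof.
move=> f1c f2c Hs R1s R2s mono1 mono2 bcd.
have [s1 s2] := bcd_subdiff k f1c f2c Hs R1s R2s bcd.
rewrite /kkt_point col_mxKu col_mxKd mulmx_sym_col // -{1 2}(vsubmxK g).
rewrite add_col_mx opp_col_mx col_mxKu col_mxKd => -[k1 k2].
have [_ pr1 _] := f1c; have [_ pr2 _] := f2c.
have m1 := mono1 _ _ _ _ (subdiff_dom pr1 s1) (subdiff_dom pr1 k1) s1 k1.
have m2 := mono2 _ _ _ _ (subdiff_dom pr2 s2) (subdiff_dom pr2 k2) s2 k2.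
apply: energy_descent => //; [move: m1|move: m2]; congr (_ <= dotv _ _).
  rewrite opprK (_ : x1 k.+1 - p1 - (x1 k - p1) = x1 k.+1 - x1 k); last first.
    by apply/matrixP => i j; rewrite !mxE; ring.
  rewrite !mulmxBr; apply/matrixP => i j; rewrite !mxE; ring.
rewrite opprK (_ : x2 k.+1 - p2 - (x2 k - p2) = x2 k.+1 - x2 k); last first.
  by apply/matrixP => i j; rewrite !mxE; ring.
rewrite !mulmxBr; apply/matrixP => i j; rewrite !mxE; ring.
Qed.

(** The optimality conditions of the subproblems differ from the KKT conditions at
    the new iterate only by the three terms assumed to vanish. *)
Lemma bcd_limit_kkt (R : realType) (U : set_system nat) {PU : ProperFilter U}
    d1 d2 (f1 : 'cV[R]_d1 -> \bar R) (f2 : 'cV[R]_d2 -> \bar R)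
    (H : 'M[R]_(d1 + d2)) (g : 'cV[R]_(d1 + d2)) (R1 : 'M[R]_d1)
    (R2 : 'M[R]_d2) x1 x2 (p1 : 'cV[R]_d1) (p2 : 'cV[R]_d2) :
  closed_proper_convex f1 -> closed_proper_convex f2 ->
  H^T = H -> R1^T = R1 -> R2^T = R2 ->
  cyclic_prox_bcd f1 f2 H g R1 R2 x1 x2 ->
  x1 k.+1 @[k --> U] --> p1 -> x2 k.+1 @[k --> U] --> p2 ->
  R1 *m (x1 k.+1 - x1 k) @[k --> U] --> (0 : 'cV[R]_d1) ->
  R2 *m (x2 k.+1 - x2 k) @[k --> U] --> (0 : 'cV[R]_d2) ->
  ursubmx H *m (x2 k.+1 - x2 k) @[k --> U] --> (0 : 'cV[R]_d1) ->
  kkt_point f1 f2 H g (col_mx p1 p2).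
Proof.
move=> f1c f2c Hs R1s R2s bcd x1p x2p R1D R2D HD.
have sub k := bcd_subdiff k f1c f2c Hs R1s R2s bcd.
have [lsc1 [f1Ny _] _] := f1c; have [lsc2 [f2Ny _] _] := f2c.
rewrite /kkt_point col_mxKu col_mxKd mulmx_sym_col // -{1 2}(vsubmxK g).
rewrite add_col_mx opp_col_mx col_mxKu col_mxKd; split.
  apply: (subdiff_closed lsc1 f1Ny (fun k => (sub k).1) x1p).
  (* the first block was computed with the old second block, whose limit is
     known only through H12 *)
  have x2E k : ursubmx H *m x2 k
      = ursubmx H *m x2 k.+1 - ursubmx H *m (x2 k.+1 - x2 k).
    by rewrite -mulmxBr subKr.
  under eq_fun => k do rewrite x2E.
  rewrite -[_ + usubmx g]addr0 -[ursubmx H *m p2]subr0.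
  apply: cvgN; apply: cvgD R1D; apply: cvgD; last exact: cvg_cst.
  by apply: cvgD; [|apply: cvgB HD]; apply: cvg_mulmx => //; exact: cvg_cst.
apply: (subdiff_closed lsc2 f2Ny (fun k => (sub k).2) x2p).
rewrite -[_ + dsubmx g]addr0.
apply: cvgN; apply: cvgD R2D; apply: cvgD; last exact: cvg_cst.
by apply: cvgD; apply: cvg_mulmx => //; exact: cvg_cst.
Qed.

Theorem corollary2 (R : realType) (d1 d2 : nat)
  (theta1 : 'cV[R]_d1 -> \bar R) (theta2 : 'cV[R]_d2 -> \bar R)
  (H : 'M[R]_(d1 + d2)) (g : 'cV[R]_(d1 + d2))
  (Sigma1 R1 : 'M[R]_d1) (Sigma2 R2 : 'M[R]_d2)
  (x1 : nat -> 'cV[R]_d1) (x2 : nat -> 'cV[R]_d2)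
  (theta1_cpc : closed_proper_convex theta1)
  (theta2_cpc : closed_proper_convex theta2)
  (H_psd : psdmx H)
  (kkt_exists : exists x : 'cV[R]_(d1 + d2), kkt_point theta1 theta2 H g x)
  (Sigma1_psd : psdmx Sigma1) (Sigma2_psd : psdmx Sigma2)
  (Sigma1_mono : strong_monotone_subdiff theta1 Sigma1)
  (Sigma2_mono : strong_monotone_subdiff theta2 Sigma2)
  (R1_psd : psdmx R1) (R2_psd : psdmx R2)
  (pd1 : pdmx (ulsubmx H + Sigma1 + R1))
  (pd2 : pdmx (drsubmx H + Sigma2 + R2))
  (bcd : cyclic_prox_bcd theta1 theta2 H g R1 R2 x1 x2) :
  exists xstar : 'cV[R]_(d1 + d2),
    argmin (objective theta1 theta2 H g) xstar /\
    (fun k : nat => col_mx (x1 k) (x2 k)) @ \oo --> xstar.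
Proof.
have [Hs _] := H_psd; have [R1s _] := R1_psd; have [R2s _] := R2_psd.
pose E p1 p2 k := energy H R1 R2 (x1 k - p1) (x2 k - p2).
pose D p1 p2 k := dissipation H Sigma1 R1 Sigma2 R2 (x1 k - p1) (x2 k - p2)
                              (x1 k.+1 - p1) (x2 k.+1 - p2).
have E0 p1 p2 k : 0 <= E p1 p2 k by exact: energy_ge0.
have D0 p1 p2 k : 0 <= D p1 p2 k by exact: dissipation_ge0.
have ED p1 p2 k : kkt_point theta1 theta2 H g (col_mx p1 p2) ->
    E p1 p2 k.+1 + D p1 p2 k <= E p1 p2 k by exact: bcd_energy_descent.
have err1 p1 p2 k : kkt_point theta1 theta2 H g (col_mx p1 p2) ->
    sqnorm (ulsubmx H + Sigma1 + R1) (x1 k.+1 - p1) <= 3 * E p1 p2 k.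
  move=> /(ED p1 p2 k) ED'.
  apply: le_trans (_ : 3 * (E p1 p2 k.+1 + D p1 p2 k) <= _).
    exact: block1_error_le.
  by rewrite ler_pM2l.
have err2 p1 p2 k : kkt_point theta1 theta2 H g (col_mx p1 p2) ->
    sqnorm (drsubmx H + Sigma2 + R2) (x2 k.+1 - p2) <= E p1 p2 k.
  move=> /(ED p1 p2 k); apply: le_trans.
  exact: block2_error_le.
have [x kktx] := kkt_exists; rewrite -(vsubmxK x) in kktx.
set q1 := usubmx x in kktx; set q2 := dsubmx x in kktx.
have [_ Dq] := descent_cvg (E0 q1 q2) (D0 q1 q2) (fun k => ED q1 q2 k kktx).
have Ele k : E q1 q2 k <= E q1 q2 0%N.
  by elim: k => // k; have := ED q1 q2 k kktx; have := D0 q1 q2 k; lra.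
(* a refinement of k -> oo along which bounded sequences converge *)
have [U [UU sub]] := ultraFilterLemma eventually_filter.
have PU : ProperFilter U by exact: ultra_proper.
have [p1 y1p] : exists p : 'cV[R]_d1, x1 k.+1 @[k --> U] --> p.
  apply: (pd_ultra_cvg (p := q1) (M := 3 * E q1 q2 0%N) pd1) => k.
  apply: le_trans (err1 q1 q2 k kktx) _.
  by rewrite ler_pM2l.
have [p2 y2p] : exists p : 'cV[R]_d2, x2 k.+1 @[k --> U] --> p.
  apply: (pd_ultra_cvg (p := q2) (M := E q1 q2 0%N) pd2) => k.
  by apply: le_trans (err2 q1 q2 k kktx) _.
have DU : D q1 q2 k @[k --> U] --> (0 : R) by move=> A /Dq; exact: sub.
have kktp : kkt_point theta1 theta2 H g (col_mx p1 p2).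
  have [] := dissipation_cvg0 H_psd Sigma1_psd Sigma2_psd R1_psd R2_psd DU.
  have step n (u v w : 'cV[R]_n) : u - w - (v - w) = u - v.
    by rewrite opprB addrA subrK.
  under eq_fun do rewrite step; move=> R1D.
  under eq_fun do rewrite step; move=> R2D.
  under eq_fun do rewrite step; move=> HD.
  exact: (bcd_limit_kkt theta1_cpc theta2_cpc Hs R1s R2s bcd y1p y2p R1D R2D HD).
(* the descent now holds around p, where the energy vanishes along U *)
have [[l El] _] := descent_cvg (E0 p1 p2) (D0 p1 p2) (fun k => ED p1 p2 k kktp).
have l0 : l = 0.
  have ElU : E p1 p2 k.+1 @[k --> U] --> l.
    by rewrite -(cvg_shiftS (E p1 p2)) in El; move=> A /El; exact: sub.
  suff : E p1 p2 k.+1 @[k --> U] --> (0 : R).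
    by apply: cvg_unique ElU; exact: Rhausdorff.
  rewrite -[X in _ --> X]addr0 -[X in _ --> X + _]addr0.
  apply: cvgD; last exact: cvg_sqnormB y2p.
  by apply: cvgD; [exact: cvg_sqnormB y1p|exact: cvg_sqnormB y2p].
rewrite {}l0 in El.
have x1p : x1 @ \oo --> p1.
  rewrite -(cvg_shiftS x1); apply: (pd_cvg pd1).
  apply: (dominated_cvg0 (c := 3)) El => k.
  by rewrite err1 // andbT; exact: (pd_psd pd1).2.
have x2p : x2 @ \oo --> p2.
  rewrite -(cvg_shiftS x2); apply: (pd_cvg pd2).
  apply: (dominated_cvg0 (c := 1)) El => k.
  by rewrite mul1r err2 // andbT; exact: (pd_psd pd2).2.
exists (col_mx p1 p2); split; first exact: kkt_argmin.
exact: cvg_col_mx.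
Qed.
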